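(* Consider the steady state of the discrete-time queue with batch-size-dependent service and single ($\delta_p=0$) or multiple ($\delta_p=1$) vacations described in the context, and suppose $a<b$. The joint probabilities $p^+_{n,r}$ of queue length $n$ and server content $r$ at service completion epoch satisfy, for all $n\ge0$, $$p^+_{n,a}=\Big[(1-\delta_p)\sum_{m=0}^{a-1}Q^+_m+p^+_a+Q^+_a\Big]k^{(a)}_n,$$ $$p^+_{n,j}=(p^+_j+Q^+_j)\,k^{(j)}_n,\quad a+1\le j\le b-1,$$ and, for all complex $x$ with $|x|\le1$, $x\ne0$, $x^b\neq K^{(b)}(x)$, $$\begin{aligned}\sum_{n=0}^\infty p^+_{n,b}x^n=\;&\frac1{x^b-K^{(b)}(x)}\Big[\sum_{n=0}^{a-1}p^+_nx^n\big(H(x)-1\big)K^{(b)}(x)+(1-\delta_p)K^{(a)}(x)K^{(b)}(x)\sum_{n=0}^{a-1}Q^+_n\\&+\big(\delta_pH(x)-1\big)\sum_{n=0}^{a-1}Q^+_nx^nK^{(b)}(x)+\sum_{n=a}^{b-1}(p^+_n+Q^+_n)\big(K^{(n)}(x)-x^{n-b}K^{(b)}(x)\big)K^{(b)}(x)\Big]\\&-\sum_{n=a}^{b-1}(p^+_n+Q^+_n)x^{n-b}K^{(b)}(x).\end{aligned}$$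
   Context: Parameters: integers $1\le a\le b$; $0<\lambda<1$, $\bar\lambda=1-\lambda$ (Bernoulli arrivals, one customer per slot with probability $\lambda$); $\delta_p\in\{0,1\}$ ($0$: single vacation, $1$: multiple vacation). For $a\le r\le b$, the service time of a batch of size $r$ has pmf $s_r(u)$, $u\ge1$, pgf $S_r^*(z)=\sum_{u\ge1}s_r(u)z^u$ and finite mean $s_r=1/\mu_r$; a vacation has pmf $v(u)$, $u\ge 1$, pgf $V^*(z)=\sum_{u\ge1}v(u)z^u$ and finite mean $E(V)$. Stability: $\lambda/(b\mu_b)<1$. Customers are served in batches by the $(a,b)$ rule: service starts only if at least $a$ customers wait; all are taken if there are between $a$ and $b$, otherwise exactly $b$. After a service, if fewer than $a$ wait, the server takes a vacation; if fewer than $a$ wait at the end of a vacation, the server stays dormant until $a$ have accumulated (single vacation) or takes another vacation (multiple vacation). The system is late arrival with delayed access: in each slot a potential arrival occurs just before, and a potential departure just after, the slot boundary. Steady-state probabilities just before a slot boundary: $p_{n,0}$ ($0\le n\le a-1$): server dormant, $n$ in queue; $p_{n,r}(u)$ ($n\ge0$, $a\le r\le b$, $u\ge1$): server busy with a batch of $r$, remaining service time $u$, $n$ in queue; $Q_n(u)$ ($n\ge0,u\ge1$): server on vacation with remaining vacation time $u$, $n$ in queue. They are nonnegative, satisfy $$p_{0,0}=(1-\delta_p)\bar\lambda\,(p_{0,0}+Q_0(1)),$$ $$p_{n,0}=(1-\delta_p)\big[\bar\lambda p_{n,0}+\lambda p_{n-1,0}+\bar\lambda Q_n(1)+\lambda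 Q_{n-1}(1)\big],\quad 1\le n\le a-1,$$ $$p_{0,a}(u)=\bar\lambda p_{0,a}(u+1)+\Big[\sum_{m=a}^b(\bar\lambda p_{a,m}(1)+\lambda p_{a-1,m}(1))+\bar\lambda Q_a(1)+\lambda Q_{a-1}(1)+(1-\delta_p)\lambda p_{a-1,0}\Big]s_a(u),$$ $$p_{0,r}(u)=\bar\lambda p_{0,r}(u+1)+\Big[\sum_{m=a}^b(\bar\lambda p_{r,m}(1)+\lambda p_{r-1,m}(1))+\bar\lambda Q_r(1)+\lambda Q_{r-1}(1)\Big]s_r(u),\quad a+1\le r\le b,$$ $$p_{n,r}(u)=\bar\lambda p_{n,r}(u+1)+\lambda p_{n-1,r}(u+1),\quad n\ge1,\ a\le r\le b-1,$$ $$p_{n,b}(u)=\bar\lambda p_{n,b}(u+1)+\lambda p_{n-1,b}(u+1)+\Big[\sum_{m=a}^b(\bar\lambda p_{n+b,m}(1)+\lambda p_{n+b-1,m}(1))+\bar\lambda Q_{n+b}(1)+\lambda Q_{n+b-1}(1)\Big]s_b(u),\quad n\ge1,$$ $$Q_0(u)=\bar\lambda Q_0(u+1)+\bar\lambda\Big[\sum_{m=a}^bp_{0,m}(1)+\delta_pQ_0(1)\Big]v(u),$$ $$Q_n(u)=\bar\lambda Q_n(u+1)+\lambda Q_{n-1}(u+1)+\Big[\sum_{m=a}^b(\bar\lambda p_{n,m}(1)+\lambda p_{n-1,m}(1))+\delta_p(\bar\lambda Q_n(1)+\lambda Q_{n-1}(1))\Big]v(u),\quad 1\le n\le a-1,$$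 $$Q_n(u)=\bar\lambda Q_n(u+1)+\lambda Q_{n-1}(u+1),\quad n\ge a,$$ and, with $p_{n,r}=\sum_{u\ge1}p_{n,r}(u)$ and $Q_n=\sum_{u\ge1}Q_n(u)$, the normalization $(1-\delta_p)\sum_{n=0}^{a-1}p_{n,0}+\sum_{n\ge0}\sum_{r=a}^bp_{n,r}+\sum_{n\ge0}Q_n=1$. Epoch probabilities: with $\tau=\sum_{m\ge0}\sum_{r=a}^bp_{m,r}(1)+\sum_{m\ge0}Q_m(1)$, set $p^+_{0,r}=\tau^{-1}\bar\lambda p_{0,r}(1)$, $p^+_{n,r}=\tau^{-1}(\bar\lambda p_{n,r}(1)+\lambda p_{n-1,r}(1))$ for $n\ge1$ (service completion of a batch of size $r$ leaving $n$ in queue), $p_n^+=\sum_{r=a}^bp^+_{n,r}$, and $Q_0^+=\tau^{-1}\bar\lambda Q_0(1)$, $Q_n^+=\tau^{-1}(\bar\lambda Q_n(1)+\lambda Q_{n-1}(1))$ for $n\ge1$ (vacation termination with $n$ in queue). Finally $K^{(r)}(x)=S_r^*(\bar\lambda+\lambda x)=\sum_{j\ge0}k_j^{(r)}x^j$ for $a\le r\le b$ and $H(x)=V^*(\bar\lambda+\lambda x)=\sum_{j\ge0}h_jx^j$ (pgfs of the number of arrivals during a service of a batch of size $r$, respectively during a vacation). *)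

(* Defs.v *)
From Stdlib Require Import Reals Lra Lia.
From Coquelicot Require Import Coquelicot.
Open Scope R_scope.

(* A function on {1, 2, ...} is a function on [nat] whose value
   at 0 is irrelevant, and its sum over u >= 1 is the series of
   [fun i => f (S i)].  The Coquelicot sum [sum_n_m f m n] runs over
   m <= i <= n, both ends included. *)

(* Coquelicot's [Series] is real-valued; this is its complex analogue. *)
Definition CSeries (c : nat -> C) : C :=
  (Series (fun n => Re (c n)), Series (fun n => Im (c n))).

Definition is_Cseries (c : nat -> C) (l : C) : Prop :=
  @is_series C_AbsRing C_NormedModule c l.

Lemma sum_n_C (c : nat -> C) (n : nat) :
  sum_n c n = (sum_n (fun i => Re (c i)) n, sum_n (fun i => Im (c i)) n).
Proof.
induction n as [|n IH].
- rewrite !sum_O; now destruct (c O).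
- rewrite !sum_Sn, IH; reflexivity.
Qed.

Lemma is_Cseries_unique (c : nat -> C) (l : C) :
  is_Cseries c l -> CSeries c = l.
Proof.
intros H; unfold CSeries; destruct l as [x y]; f_equal;
  apply is_series_unique; intros P [e He].
- destruct (H (fun z => P (Re z))) as [N HN].
  + exists e; intros z [Hz _]; apply He; exact Hz.
  + exists N; intros n Hn; generalize (HN n Hn); now rewrite sum_n_C.
- destruct (H (fun z => P (Im z))) as [N HN].
  + exists e; intros z [_ Hz]; apply He; exact Hz.
  + exists N; intros n Hn; generalize (HN n Hn); now rewrite sum_n_C.
Qed.

Definition is_pmf (f : nat -> R) : Prop :=
  (forall u : nat, (1 <= u)%nat -> 0 <= f u) /\
  is_series (fun i => f (S i)) 1.

Definition has_finite_mean (f : nat -> R) : Prop :=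
  ex_series (fun i => INR (S i) * f (S i)).

Definition mean (f : nat -> R) : R := Series (fun i => INR (S i) * f (S i)).

Definition pgf (f : nat -> R) (z : C) : C :=
  CSeries (fun i => (RtoC (f (S i)) * z ^ S i)%C).

Record queue := Queue {
  qa : nat;                 (* service starts with at least [qa] customers *)
  qb : nat;                 (* at most [qb] customers per batch *)
  lam : R;                  (* arrival probability per slot *)
  delta : R;                (* 0: single vacation, 1: multiple vacation *)
  svc : nat -> nat -> R;    (* [svc r u]: a batch of size r needs u slots *)
  vac : nat -> R            (* [vac u]: a vacation lasts u slots *)
}.

Definition lamb (q : queue) : R := 1 - lam q.

(* Service rate of a batch of size r: the mean service time is 1 / mu_r. *)
Definition mu (q : queue) (r : nat) : R := / mean (svc q r).

Record valid_queue (q : queue) : Prop := {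
  vq_a : (1 <= qa q)%nat;
  vq_ab : (qa q <= qb q)%nat;
  vq_lam : 0 < lam q < 1;
  vq_delta : delta q = 0 \/ delta q = 1;
  vq_svc_pmf : forall r : nat, (qa q <= r <= qb q)%nat -> is_pmf (svc q r);
  vq_svc_mean :
    forall r : nat, (qa q <= r <= qb q)%nat -> has_finite_mean (svc q r);
  vq_vac_pmf : is_pmf (vac q);
  vq_vac_mean : has_finite_mean (vac q);
  vq_stable : lam q / (INR (qb q) * mu q (qb q)) < 1
}.

(* [dorm n] is p_{n,0}, [busy n r u] is p_{n,r}(u), [vacn n u] is Q_n(u). *)
Record probs := Probs {
  dorm : nat -> R;
  busy : nat -> nat -> nat -> R;
  vacn : nat -> nat -> R
}.

Definition busy_tot (P : probs) (n r : nat) : R :=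
  Series (fun i => busy P n r (S i)).

Definition vacn_tot (P : probs) (n : nat) : R :=
  Series (fun i => vacn P n (S i)).

(* The [ex_series] fields say that the sums in the normalization are genuine,
   since [Series] of a divergent series is a junk value. *)
Record steady_state (q : queue) (P : probs) : Prop := {
  ss_dorm_ge0 : forall n : nat, (n <= qa q - 1)%nat -> 0 <= dorm P n;
  ss_busy_ge0 : forall n r u : nat,
    (qa q <= r <= qb q)%nat -> (1 <= u)%nat -> 0 <= busy P n r u;
  ss_vacn_ge0 : forall n u : nat, (1 <= u)%nat -> 0 <= vacn P n u;

  ss_dorm_0 :
    dorm P 0 = (1 - delta q) * (lamb q * (dorm P 0 + vacn P 0 1));

  ss_dorm_n : forall n : nat, (1 <= n <= qa q - 1)%nat ->
    dorm P n =
      (1 - delta q) *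
      (lamb q * dorm P n + lam q * dorm P (n - 1) +
       lamb q * vacn P n 1 + lam q * vacn P (n - 1) 1);

  ss_busy_0a : forall u : nat, (1 <= u)%nat ->
    busy P 0 (qa q) u =
      lamb q * busy P 0 (qa q) (u + 1) +
      (sum_n_m (fun m => lamb q * busy P (qa q) m 1 +
                         lam q * busy P (qa q - 1) m 1) (qa q) (qb q) +
       lamb q * vacn P (qa q) 1 + lam q * vacn P (qa q - 1) 1 +
       (1 - delta q) * lam q * dorm P (qa q - 1)) * svc q (qa q) u;

  ss_busy_0r : forall r u : nat,
    (qa q + 1 <= r <= qb q)%nat -> (1 <= u)%nat ->
    busy P 0 r u =
      lamb q * busy P 0 r (u + 1) +
      (sum_n_m (fun m => lamb q * busy P r m 1 +
                         lam q * busy P (r - 1) m 1) (qa q) (qb q) +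
       lamb q * vacn P r 1 + lam q * vacn P (r - 1) 1) * svc q r u;

  ss_busy_nr : forall n r u : nat,
    (1 <= n)%nat -> (qa q <= r <= qb q - 1)%nat -> (1 <= u)%nat ->
    busy P n r u =
      lamb q * busy P n r (u + 1) + lam q * busy P (n - 1) r (u + 1);

  ss_busy_nb : forall n u : nat, (1 <= n)%nat -> (1 <= u)%nat ->
    busy P n (qb q) u =
      lamb q * busy P n (qb q) (u + 1) +
      lam q * busy P (n - 1) (qb q) (u + 1) +
      (sum_n_m (fun m => lamb q * busy P (n + qb q) m 1 +
                         lam q * busy P (n + qb q - 1) m 1) (qa q) (qb q) +
       lamb q * vacn P (n + qb q) 1 +
       lam q * vacn P (n + qb q - 1) 1) * svc q (qb q) u;

  ss_vacn_0 : forall u : nat, (1 <= u)%nat ->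
    vacn P 0 u =
      lamb q * vacn P 0 (u + 1) +
      lamb q * (sum_n_m (fun m => busy P 0 m 1) (qa q) (qb q) +
                delta q * vacn P 0 1) * vac q u;

  ss_vacn_lt : forall n u : nat, (1 <= n <= qa q - 1)%nat -> (1 <= u)%nat ->
    vacn P n u =
      lamb q * vacn P n (u + 1) + lam q * vacn P (n - 1) (u + 1) +
      (sum_n_m (fun m => lamb q * busy P n m 1 +
                         lam q * busy P (n - 1) m 1) (qa q) (qb q) +
       delta q * (lamb q * vacn P n 1 + lam q * vacn P (n - 1) 1)) * vac q u;

  ss_vacn_ge : forall n u : nat, (qa q <= n)%nat -> (1 <= u)%nat ->
    vacn P n u =
      lamb q * vacn P n (u + 1) + lam q * vacn P (n - 1) (u + 1);

  ss_busy_ex : forall n r : nat, (qa q <= r <= qb q)%nat ->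
    ex_series (fun i => busy P n r (S i));
  ss_vacn_ex : forall n : nat, ex_series (fun i => vacn P n (S i));
  ss_busy_tot_ex :
    ex_series (fun n => sum_n_m (fun r => busy_tot P n r) (qa q) (qb q));
  ss_vacn_tot_ex : ex_series (fun n => vacn_tot P n);

  ss_norm :
    (1 - delta q) * sum_n_m (fun n => dorm P n) 0 (qa q - 1) +
    Series (fun n => sum_n_m (fun r => busy_tot P n r) (qa q) (qb q)) +
    Series (fun n => vacn_tot P n) = 1
}.

Definition tau (q : queue) (P : probs) : R :=
  Series (fun m => sum_n_m (fun r => busy P m r 1) (qa q) (qb q)) +
  Series (fun m => vacn P m 1).

(* Completion epochs: [pplus2], [pplus] and [Qplus] are p^+_{n,r}, p^+_n and
   Q^+_n. *)
Definition pplus2 (q : queue) (P : probs) (n r : nat) : R :=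
  match n with
  | O => / tau q P * (lamb q * busy P 0 r 1)
  | S n' => / tau q P * (lamb q * busy P n r 1 + lam q * busy P n' r 1)
  end.

Definition pplus (q : queue) (P : probs) (n : nat) : R :=
  sum_n_m (fun r => pplus2 q P n r) (qa q) (qb q).

Definition Qplus (q : queue) (P : probs) (n : nat) : R :=
  match n with
  | O => / tau q P * (lamb q * vacn P 0 1)
  | S n' => / tau q P * (lamb q * vacn P n 1 + lam q * vacn P n' 1)
  end.

(* [Kgf q r] and [Hgf q] are K^{(r)} and H, the generating functions of the
   number of arrivals during a service and during a vacation. *)
Definition Kgf (q : queue) (r : nat) (x : C) : C :=
  pgf (svc q r) (RtoC (lamb q) + RtoC (lam q) * x)%C.

Definition Hgf (q : queue) (x : C) : C :=
  pgf (vac q) (RtoC (lamb q) + RtoC (lam q) * x)%C.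

(* [c] is the coefficient sequence of the power series F(x) = sum_j c_j x^j
   on the closed unit disc; it is unique when it exists. *)
Definition is_gf_coeffs (F : C -> C) (c : nat -> R) : Prop :=
  forall x : C, Cmod x <= 1 ->
    is_Cseries (fun j => (RtoC (c j) * x ^ j)%C) (F x).

Definition Csum (f : nat -> C) (m n : nat) : C :=
  @sum_n_m C_AbelianMonoid f m n.

(* Main.v *)
(* Fix the batch size and regard [p_{n,r}(u)] as a sequence in n. One slot of
   arrivals acts on such sequences by the operator [step], multiplication by
   [1 - lam + lam x] on generating functions, and the balance equations read
   [p(u) = step p(u+1) + c s(u)], where [c] collects the epochs that start a
   service. Unrolling them gives [step p(1) = sum_u s(u) step^u c], so the
   sequence at completion epochs has generating function [K(x) C(x)]; the same
   holds for vacations. For r < b the source [c] sits at n = 0, which gives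
   the first two claims; the source of the dormant state telescopes to
   [sum_{m<a} Q^+_m]. For r = b it is [p^+_{n+b} + Q^+_{n+b}], and comparing the
   two expressions of [sum_n (p^+_n + Q^+_n) x^n] gives a linear equation for
   [C(x)] with leading coefficient [x^b - K^{(b)}(x)]. *)

Require Import Defs.
From Stdlib Require Import Reals Lra Lia FunctionalExtensionality.
From Coquelicot Require Import Coquelicot.
Open Scope R_scope.

(** * Series *)

Lemma ex_series_Rle (a b : nat -> R) :
  (forall n, Rabs (a n) <= b n) -> ex_series b -> ex_series a.
Proof. exact (@ex_series_le R_AbsRing R_CompleteNormedModule a b). Qed.

Lemma sum_n_le_Series (a : nat -> R) (N : nat) :
  (forall n, 0 <= a n) -> ex_series a -> sum_n a N <= Series a.
Proof.
intros Ha [l Hl]; rewrite (is_series_unique _ _ Hl).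
apply (is_lim_seq_incr_compare (sum_n a) l Hl).
intros n; rewrite sum_Sn; unfold plus; simpl; generalize (Ha (S n)); lra.
Qed.

Lemma term_le_Series (a : nat -> R) (n : nat) :
  (forall n, 0 <= a n) -> ex_series a -> a n <= Series a.
Proof.
intros Ha Ea; eapply Rle_trans; [|apply (sum_n_le_Series a n Ha Ea)].
destruct n as [|n]; [rewrite sum_O; lra|].
rewrite sum_Sn; unfold plus; simpl.
assert (0 <= sum_n a n); [|lra].
clear Ea; induction n as [|n IH]; [now rewrite sum_O|].
rewrite sum_Sn; unfold plus; simpl; generalize (Ha (S n)); lra.
Qed.

Lemma Rabs_sum_n (a : nat -> R) (N : nat) :
  Rabs (sum_n a N) <= sum_n (fun n => Rabs (a n)) N.
Proof. exact (norm_sum_n_m a 0 N). Qed.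

Lemma is_series_Rext (a b : nat -> R) (l : R) :
  (forall n, a n = b n) -> is_series a l -> is_series b l.
Proof. apply is_series_ext. Qed.

Lemma is_series_Rscal (r : R) (a : nat -> R) (l : R) :
  is_series a l -> is_series (fun n => r * a n) (r * l).
Proof. exact (@is_series_scal R_AbsRing R_NormedModule r a l). Qed.

Lemma ex_series_Rscal (r : R) (a : nat -> R) :
  ex_series a -> ex_series (fun n => r * a n).
Proof. exact (@ex_series_scal R_AbsRing R_NormedModule r a). Qed.

Lemma is_series_sum_n (F : nat -> nat -> R) (s : nat -> R) (N : nat) :
  (forall n, is_series (F n) (s n)) ->
  is_series (fun i => sum_n (fun n => F n i) N) (sum_n s N).
Proof.
intros H; induction N as [|N IH].
- rewrite sum_O; eapply is_series_ext; [|apply H].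
  intros i; now rewrite sum_O.
- rewrite sum_Sn; eapply is_series_ext; [|apply (is_series_plus _ _ _ _ IH (H (S N)))].
  intros i; now rewrite sum_Sn.
Qed.

Lemma Series_tail_small (B : nat -> R) (eps : R) :
  ex_series B -> 0 < eps ->
  exists K, Rabs (Series (fun i => B (S K + i)%nat)) < eps.
Proof.
intros HB He; destruct HB as [l Hl].
assert (Hl' : is_lim_seq (sum_n B) l) by exact Hl.
apply is_lim_seq_spec in Hl'; destruct (Hl' (mkposreal eps He)) as [K HK].
exists K; simpl in HK.
generalize (Series_incr_n B (S K) (Nat.lt_0_succ K) (ex_intro _ l Hl)).
rewrite (is_series_unique _ _ Hl), <- sum_n_Reals; simpl pred; intros E.
specialize (HK K (Nat.le_refl K)).
replace (Series _) with (- (sum_n B K - l)) by lra.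
now rewrite Rabs_Ropp.
Qed.

(* Dominated convergence for series, also known as Tannery's theorem. *)
Lemma Series_dominated (a : nat -> nat -> R) (l B : nat -> R) :
  (forall i, is_lim_seq (fun N => a N i) (l i)) ->
  (forall N i, Rabs (a N i) <= B i) ->
  ex_series B ->
  is_lim_seq (fun N => Series (a N)) (Series l).
Proof.
intros Hl HaB HB.
assert (HlB : forall i, Rabs (l i) <= B i).
{ intros i.
  assert (H1 := is_lim_seq_abs _ _ (Hl i)).
  exact (is_lim_seq_le _ _ _ _ (fun N => HaB N i) H1 (is_lim_seq_const (B i))). }
assert (Ea : forall N, ex_series (a N)) by (intros N; now apply ex_series_Rle with B).
assert (El : ex_series l) by now apply ex_series_Rle with B.
apply is_lim_seq_spec; intros [eps He]; simpl.
destruct (Series_tail_small B (eps / 3)) as [K HK]; [easy|lra|].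
(* Stated for every sequence dominated by [B], so that it bounds the tails of both [a N] and [l];
   the third [eps / 3] goes to the finite partial sums. *)
assert (tail : forall b, (forall i, Rabs (b i) <= B i) ->
  Rabs (Series (fun i => b (S K + i)%nat)) < eps / 3).
{ intros b Hb.
  assert (EB : ex_series (fun i => B (S K + i)%nat)) by now apply -> (ex_series_incr_n B (S K)).
  assert (Eb : ex_series (fun i => Rabs (b (S K + i)%nat))).
  { apply ex_series_Rle with (2 := EB); intros i; rewrite Rabs_Rabsolu; apply Hb. }
  eapply Rle_lt_trans; [apply Series_Rabs, Eb|].
  eapply Rle_lt_trans; [apply Series_le with (2 := EB)|].
  - intros i; split; [apply Rabs_pos|apply Hb].
  - eapply Rle_lt_trans; [apply Rle_abs|exact HK]. }
assert (Hs : is_lim_seq (fun N => sum_n (a N) K) (sum_n l K)).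
{ clear - Hl; induction K as [|K IH].
  - rewrite sum_O; apply is_lim_seq_ext with (2 := Hl O); intros N; now rewrite sum_O.
  - rewrite sum_Sn; apply is_lim_seq_ext with (fun N => sum_n (a N) K + a N (S K)).
    + intros N; now rewrite sum_Sn.
    + now apply is_lim_seq_plus'. }
apply is_lim_seq_spec in Hs.
assert (He3 : 0 < eps / 3) by lra.
destruct (Hs (mkposreal _ He3)) as [M HM]; simpl in HM.
exists M; intros N HN; specialize (HM N HN).
rewrite (Series_incr_n (a N) (S K)), (Series_incr_n l (S K)) by (easy || lia).
simpl pred; rewrite <- !sum_n_Reals.
generalize (tail (a N) (HaB N)) (tail l HlB) HM; clear.
intros H1 H2 H3; apply Rabs_def2 in H1, H2, H3; apply Rabs_def1; lra.
Qed.

(** * One slot of Bernoulli arrivals *)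

(* [c n] weighs the states with [n] customers before the slot, [step l c n]
   those with [n] customers after it. *)
Definition step (l : R) (c : nat -> R) (n : nat) : R :=
  match n with
  | O => (1 - l) * c O
  | S m => (1 - l) * c n + l * c m
  end.

Definition steps (l : R) (u : nat) : (nat -> R) -> nat -> R :=
  Nat.iter u (step l).

Lemma steps_succ_r (l : R) (u : nat) (c : nat -> R) :
  steps l (S u) c = steps l u (step l c).
Proof. apply Nat.iter_succ_r. Qed.

Lemma step_linear (l r : R) (a b : nat -> R) (n : nat) :
  step l (fun m => a m + r * b m) n = step l a n + r * step l b n.
Proof. destruct n; simpl; ring. Qed.

(** The shape [a + r * b] is that of a balance equation: [a] is the propagated state, [b] the source
    and [r] the value of the pmf. *)
Lemma steps_linear (l r : R) (u : nat) (a b : nat -> R) (n : nat) :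
  steps l u (fun m => a m + r * b m) n = steps l u a n + r * steps l u b n.
Proof.
revert n; induction u as [|u IH]; intros n; [reflexivity|].
change (step l (steps l u (fun m => a m + r * b m)) n =
  step l (steps l u a) n + r * step l (steps l u b) n).
rewrite (functional_extensionality _ _ IH); apply step_linear.
Qed.

Lemma step_bound (l M : R) (a : nat -> R) (n : nat) :
  0 <= l <= 1 -> 0 <= M -> (forall m, (m <= n)%nat -> 0 <= a m <= M) ->
  0 <= step l a n <= M.
Proof.
intros Hl HM Ha; destruct n as [|n]; simpl.
- generalize (Ha O (le_n O)); nra.
- generalize (Ha (S n) (le_n _)) (Ha n (le_S _ _ (le_n n))); nra.
Qed.

(** Customers only accumulate, so entry [n] is a sub-convex combination of the entries up to [n].
    Bounding just these allows an [M] that depends on [n]. *)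
Lemma steps_bound (l M : R) (u : nat) (a : nat -> R) (n : nat) :
  0 <= l <= 1 -> 0 <= M -> (forall m, (m <= n)%nat -> 0 <= a m <= M) ->
  0 <= steps l u a n <= M.
Proof.
intros Hl HM; revert n; induction u as [|u IH]; intros n Ha; [now apply Ha|].
apply step_bound; [easy|easy|]; intros m Hm; apply IH; intros i Hi; apply Ha; lia.
Qed.

Lemma sum_n_Rabs_step (l : R) (a : nat -> R) (N : nat) :
  0 <= l <= 1 ->
  sum_n (fun n => Rabs (step l a n)) N <= sum_n (fun n => Rabs (a n)) N.
Proof.
intros Hl.
(* The extra term is the mass that an arrival moves from [N] to [N + 1], out of the partial sum;
   keeping it makes the induction go through. *)
assert (H : sum_n (fun n => Rabs (step l a n)) N + l * Rabs (a N)
  <= sum_n (fun n => Rabs (a n)) N).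
{ induction N as [|N IH].
  - rewrite !sum_O; simpl; rewrite Rabs_mult, (Rabs_pos_eq (1 - l)) by lra; lra.
  - rewrite !sum_Sn; unfold plus; simpl.
    generalize (Rabs_triang ((1 - l) * a (S N)) (l * a N)).
    rewrite !Rabs_mult, (Rabs_pos_eq (1 - l)), (Rabs_pos_eq l) by lra; lra. }
generalize (Rabs_pos (a N)); nra.
Qed.

Lemma sum_n_Rabs_steps (l : R) (u : nat) (a : nat -> R) (N : nat) :
  0 <= l <= 1 ->
  sum_n (fun n => Rabs (steps l u a n)) N <= sum_n (fun n => Rabs (a n)) N.
Proof.
intros Hl; induction u as [|u IH]; [apply Rle_refl|].
eapply Rle_trans; [apply (sum_n_Rabs_step l (steps l u a) N Hl)|exact IH].
Qed.

(* Unrolling the balance equation [N] times leaves the remainder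
   [steps l N (g _ N)], which vanishes because [g n u] is summable in [u]. *)
Lemma balance_unroll (l : R) (g : nat -> nat -> R) (c f : nat -> R) (n : nat) :
  0 <= l <= 1 ->
  (forall m u, 0 <= g m (S u)) ->
  (forall m, ex_series (fun i => g m (S i))) ->
  (forall m u, g m (S u) =
     step l (fun i => g i (S (S u))) m + c m * f (S u)) ->
  is_series (fun i => f (S i) * steps l (S i) c n)
            (step l (fun m => g m 1%nat) n).
Proof.
intros Hl Hg Eg Hb.
assert (HN : forall N, step l (fun m => g m 1%nat) n =
  sum_n (fun i => f (S i) * steps l (S i) c n) N
  + steps l (S (S N)) (fun m => g m (S (S N))) n).
{ assert (Hs : forall N, steps l (S N) (fun m => g m (S N)) n =
    f (S N) * steps l (S N) c n + steps l (S (S N)) (fun m => g m (S (S N))) n).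
  { intros N; rewrite (steps_succ_r l (S N)).
    rewrite (functional_extensionality (fun m => g m (S N))
      (fun m => step l (fun i => g i (S (S N))) m + f (S N) * c m)).
    - rewrite steps_linear; ring.
    - intros m; rewrite Hb; ring. }
  induction N as [|N IH].
  - rewrite sum_O, <- Hs; reflexivity.
  - rewrite sum_Sn; unfold plus; simpl AbelianMonoid.sort.
    rewrite IH, (Hs (S N)); unfold plus; simpl; ring. }
assert (Hr : is_lim_seq (fun N => steps l (S (S N)) (fun m => g m (S (S N))) n) 0).
(* The remainder lies between 0 and the finite sum of the [g m] over [m <= n], each of which tends
   to 0 as the term of a convergent series. *)
{ apply is_lim_seq_le_le with (fun _ => 0) (fun N => sum_n (fun m => g m (S (S N))) n).
  - intros N; apply steps_bound; [easy| |].
    + clear -Hg; induction n as [|n IH]; [rewrite sum_O; apply Hg|].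
      rewrite sum_Sn; apply Rplus_le_le_0_compat; [exact IH|apply Hg].
    + clear -Hg; induction n as [|n IH]; intros m Hm.
      * replace m with O by lia; rewrite sum_O; split; [apply Hg|lra].
      * rewrite sum_Sn; unfold plus; simpl.
        assert (H0 := Hg (S n) (S N)).
        destruct (Nat.eq_dec m (S n)) as [->|Hm'].
        -- assert (H1 := IH O (Nat.le_0_l n)); lra.
        -- assert (H1 := IH m ltac:(lia)); lra.
  - apply is_lim_seq_const.
  - clear -Eg; induction n as [|n IH].
    + apply is_lim_seq_ext with (fun N => g O (S (S N))).
      * intros N; now rewrite sum_O.
      * apply (is_lim_seq_incr_1 (fun N => g O (S N))), ex_series_lim_0, Eg.
    + apply is_lim_seq_ext with
        (fun N => sum_n (fun m => g m (S (S N))) n + g (S n) (S (S N))).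
      * intros N; now rewrite sum_Sn.
      * replace 0 with (0 + 0) by ring; apply is_lim_seq_plus'; [exact IH|].
        apply (is_lim_seq_incr_1 (fun N => g (S n) (S N))), ex_series_lim_0, Eg. }
change (is_lim_seq (sum_n (fun i => f (S i) * steps l (S i) c n))
  (step l (fun m => g m 1%nat) n)).
apply is_lim_seq_ext with (fun N => step l (fun m => g m 1%nat) n -
  steps l (S (S N)) (fun m => g m (S (S N))) n).
- intros N; rewrite (HN N); ring.
- replace (Finite (step l (fun m => g m 1%nat) n))
    with (Finite (step l (fun m => g m 1%nat) n - 0)) by (f_equal; ring).
  apply is_lim_seq_minus'; [apply is_lim_seq_const|exact Hr].
Qed.

(* Summation by columns of the double series [f (S i) * steps l (S i) c n * w n]. *)
Lemma is_series_steps_weighted (l : R) (c f d w s : nat -> R) :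
  0 <= l <= 1 ->
  is_pmf f ->
  ex_series (fun n => Rabs (c n)) ->
  (forall n, Rabs (w n) <= 1) ->
  (forall n, is_series (fun i => f (S i) * steps l (S i) c n) (d n)) ->
  (forall u, is_series (fun n => steps l u c n * w n) (s u)) ->
  is_series (fun n => d n * w n) (Series (fun i => f (S i) * s (S i))).
Proof.
intros Hl [Hf Ef] Ec Hw Hd Hs.
set (S_ := fun N u => sum_n (fun n => steps l u c n * w n) N).
(* Since [step] contracts the l1 norm, the partial sums are bounded uniformly in [N] and [u]. Hence
   the norm of [c] times the pmf is a dominating sequence for the interchange of limits. *)
assert (HS : forall N u, Rabs (S_ N u) <= Series (fun n => Rabs (c n))).
{ intros N u; eapply Rle_trans; [apply Rabs_sum_n|].
  eapply Rle_trans; [|apply (sum_n_le_Series _ N (fun n => Rabs_pos (c n)) Ec)].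
  eapply Rle_trans; [|apply (sum_n_Rabs_steps l u c N Hl)].
  apply sum_n_m_le; intros n; rewrite Rabs_mult.
  generalize (Rabs_pos (steps l u c n)) (Hw n); nra. }
change (is_lim_seq (sum_n (fun n => d n * w n))
  (Series (fun i => f (S i) * s (S i)))).
apply (is_lim_seq_ext (fun N => Series (fun i => f (S i) * S_ N (S i)))).
- intros N; apply is_series_unique.
  eapply is_series_ext; [|apply is_series_sum_n].
  + intros i; unfold S_; symmetry.
    rewrite <- (sum_n_mult_l (f (S i)) (fun n => steps l (S i) c n * w n)).
    apply sum_n_ext; intros n.
    instantiate (1 := fun n i => w n * (f (S i) * steps l (S i) c n)).
    unfold mult; simpl; ring.
  + intros n; simpl.
    rewrite Rmult_comm.
    apply is_series_Rscal, Hd.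
- apply Series_dominated with (fun i => Series (fun n => Rabs (c n)) * f (S i)).
  + intros i.
    apply (is_lim_seq_scal_l (fun N => S_ N (S i)) (f (S i)) (s (S i))).
    exact (Hs (S i)).
  + intros N i; rewrite Rabs_mult, (Rabs_pos_eq (f (S i))) by (apply Hf; lia).
    generalize (HS N (S i)) (Hf (S i) ltac:(lia)); nra.
  + apply ex_series_Rscal; now exists 1.
Qed.

(** * Complex series *)

(** Balls in [C] are products of real balls, so convergence is checked coordinatewise. This
    transfers the real interchange of sums to complex series. *)
Lemma is_Cseries_Re_Im (c : nat -> C) (l : C) :
  is_Cseries c l <->
  is_series (fun n => Re (c n)) (Re l) /\ is_series (fun n => Im (c n)) (Im l).
Proof.
split.
- intros H; destruct l as [x y]; split; intros P [e He].
  + destruct (H (fun z => P (Re z))) as [N HN].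
    * exists e; intros z [Hz _]; apply He; exact Hz.
    * exists N; intros n Hn; generalize (HN n Hn); now rewrite sum_n_C.
  + destruct (H (fun z => P (Im z))) as [N HN].
    * exists e; intros z [_ Hz]; apply He; exact Hz.
    * exists N; intros n Hn; generalize (HN n Hn); now rewrite sum_n_C.
- intros [H1 H2] P [e He].
  destruct (H1 (ball (Re l) e)) as [N1 HN1]; [now exists e|].
  destruct (H2 (ball (Im l) e)) as [N2 HN2]; [now exists e|].
  exists (max N1 N2); intros n Hn; apply He; rewrite sum_n_C.
  split; [apply HN1|apply HN2]; lia.
Qed.

Lemma is_Cseries_ext (c d : nat -> C) (l m : C) :
  (forall n, c n = d n) -> l = m -> is_Cseries c l -> is_Cseries d m.
Proof. intros H <-; now apply is_series_ext. Qed.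

Lemma is_Cseries_plus (c d : nat -> C) (l m : C) :
  is_Cseries c l -> is_Cseries d m ->
  is_Cseries (fun n => (c n + d n)%C) (l + m)%C.
Proof. exact (is_series_plus c d l m). Qed.

Lemma is_Cseries_scal (r : C) (c : nat -> C) (l : C) :
  is_Cseries c l -> is_Cseries (fun n => (r * c n)%C) (r * l)%C.
Proof. exact (is_series_scal r c l). Qed.

Lemma is_Cseries_eq (c : nat -> C) (l m : C) :
  is_Cseries c l -> is_Cseries c m -> l = m.
Proof.
intros Hl Hm; rewrite <- (is_Cseries_unique c l Hl); now apply is_Cseries_unique.
Qed.

Lemma is_Cseries_decr_1 (c : nat -> C) (l : C) :
  is_Cseries (fun n => c (S n)) l -> is_Cseries c (c O + l)%C.
Proof.
intros H; apply (@is_series_decr_1 C_AbsRing C_NormedModule).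
change (is_Cseries (fun n => c (S n)) (c O + l - c O)%C).
now replace (c O + l - c O)%C with l by ring.
Qed.

Lemma is_Cseries_decr_n (c : nat -> C) (n : nat) (l : C) :
  is_Cseries (fun i => c (S n + i)%nat) l -> is_Cseries c (Csum c 0 n + l)%C.
Proof.
intros H; apply (@is_series_decr_n C_AbsRing C_NormedModule) with (S n); [lia|].
change (is_Cseries (fun i => c (S n + i)%nat) (Csum c 0 n + l - Csum c 0 n)%C).
now replace (Csum c 0 n + l - Csum c 0 n)%C with l by ring.
Qed.

Lemma is_Cseries_Csum (F : nat -> nat -> C) (s : nat -> C) (m n : nat) :
  (forall i, (m <= i <= n)%nat -> is_Cseries (F i) (s i)) ->
  is_Cseries (fun j => Csum (fun i => F i j) m n) (Csum s m n).
Proof.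
assert (Z : is_Cseries (fun _ => RtoC 0) (RtoC 0)).
{ apply is_Cseries_Re_Im; simpl; split;
    apply (is_lim_seq_ext (fun _ => 0)) with (2 := is_lim_seq_const 0);
    intros i; unfold sum_n; now rewrite (sum_n_m_const_zero (G := R_AbelianMonoid)). }
intros H; unfold Csum; induction n as [|n IH].
- destruct m as [|m].
  + rewrite sum_n_n; apply is_Cseries_ext with (3 := H O ltac:(lia)); [|easy].
    intros j; now rewrite sum_n_n.
  + rewrite sum_n_m_zero by lia; eapply is_Cseries_ext with (3 := Z); [|easy].
    intros j; now rewrite sum_n_m_zero by lia.
- destruct (Nat.le_gt_cases m (S n)) as [Hm|Hm].
  + rewrite sum_n_Sm by easy.
    eapply is_Cseries_ext; [| |apply is_Cseries_plus; [apply IH|apply (H (S n))]].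
    * intros j; now rewrite sum_n_Sm.
    * easy.
    * intros i Hi; apply H; lia.
    * lia.
  + rewrite sum_n_m_zero by lia; eapply is_Cseries_ext with (3 := Z); [|easy].
    intros j; now rewrite sum_n_m_zero by lia.
Qed.

Lemma im_le_Cmod (z : C) : Rabs (Im z) <= Cmod z.
Proof. eapply Rle_trans; [apply Rmax_r|apply Rmax_Cmod]. Qed.

Lemma Cmod_pow_le1 (x : C) (n : nat) : Cmod x <= 1 -> Cmod (x ^ n) <= 1.
Proof.
intros Hx; rewrite Cmod_pow, <- (pow1 n).
apply pow_incr; split; [apply Cmod_ge_0|exact Hx].
Qed.

Lemma Re_scal (r : R) (z : C) : Re (RtoC r * z) = r * Re z.
Proof. destruct z; simpl; ring. Qed.

Lemma Im_scal (r : R) (z : C) : Im (RtoC r * z) = r * Im z.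
Proof. destruct z; simpl; ring. Qed.

Lemma is_Cseries_abs (a : nat -> R) (z : nat -> C) :
  ex_series (fun n => Rabs (a n)) -> (forall n, Cmod (z n) <= 1) ->
  is_Cseries (fun n => (RtoC (a n) * z n)%C) (CSeries (fun n => (RtoC (a n) * z n)%C)).
Proof.
intros Ha Hz; apply is_Cseries_Re_Im; split; apply Series_correct;
  apply ex_series_Rle with (2 := Ha); intros n;
  [rewrite Re_scal|rewrite Im_scal]; rewrite Rabs_mult;
  generalize (Rabs_pos (a n)) (Hz n) (re_le_Cmod (z n)) (im_le_Cmod (z n)); nra.
Qed.

Lemma ex_series_Rabs_pos (a : nat -> R) :
  (forall n, 0 <= a n) -> ex_series a -> ex_series (fun n => Rabs (a n)).
Proof. intros Ha; apply ex_series_ext; intros n; symmetry; now apply Rabs_pos_eq. Qed.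

Lemma is_Cseries_pgf (f : nat -> R) (z : C) :
  is_pmf f -> Cmod z <= 1 ->
  is_Cseries (fun i => (RtoC (f (S i)) * z ^ S i)%C) (pgf f z).
Proof.
intros [Hf Ef] Hz; apply (is_Cseries_abs (fun i => f (S i))).
- apply ex_series_Rabs_pos; [intros n; apply Hf; lia|now exists 1].
- intros n; now apply Cmod_pow_le1.
Qed.

Lemma Cmod_arrival_le1 (l : R) (x : C) :
  0 <= l <= 1 -> Cmod x <= 1 -> Cmod (RtoC (1 - l) + RtoC l * x) <= 1.
Proof.
intros Hl Hx; eapply Rle_trans; [apply Cmod_triangle|].
rewrite Cmod_mult, !Cmod_R, !Rabs_pos_eq by lra; generalize (Cmod_ge_0 x); nra.
Qed.

Lemma is_Cseries_step (l : R) (a : nat -> R) (x A : C) :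
  is_Cseries (fun n => (RtoC (a n) * x ^ n)%C) A ->
  is_Cseries (fun n => (RtoC (step l a n) * x ^ n)%C)
             ((RtoC (1 - l) + RtoC l * x) * A)%C.
Proof.
intros H.
(* An arrival shifts the sequence by one place, which multiplies its generating function by [x]. *)
assert (H1 : is_Cseries
  (fun n => match n with O => RtoC 0 | S m => (x * (RtoC (a m) * x ^ m))%C end)
  (x * A)%C).
{ eapply is_Cseries_ext with (l := (RtoC 0 + x * A)%C); [reflexivity|ring|].
  apply (is_Cseries_decr_1
    (fun n => match n with O => RtoC 0 | S m => (x * (RtoC (a m) * x ^ m))%C end)).
  now apply is_Cseries_scal. }
eapply is_Cseries_ext;
  [| |apply is_Cseries_plus;
      [apply (is_Cseries_scal (RtoC (1 - l))), H|apply (is_Cseries_scal (RtoC l)), H1]].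
- intros [|n]; simpl; rewrite ?RtoC_plus, !RtoC_mult; ring.
- ring.
Qed.

Lemma is_Cseries_steps (l : R) (u : nat) (a : nat -> R) (x A : C) :
  is_Cseries (fun n => (RtoC (a n) * x ^ n)%C) A ->
  is_Cseries (fun n => (RtoC (steps l u a n) * x ^ n)%C)
             ((RtoC (1 - l) + RtoC l * x) ^ u * A)%C.
Proof.
intros H; induction u as [|u IH].
- eapply is_Cseries_ext with (3 := H); [easy|simpl; ring].
- eapply is_Cseries_ext; [| |apply (is_Cseries_step l (steps l u a) x _ IH)];
    [easy|simpl; ring].
Qed.

(* The number of arrivals during [u] slots has generating function
   [(1 - l + l x) ^ u], so mixing over the pmf [f] of [u] produces the factor
   [pgf f (1 - l + l x)]. *)
Lemma is_Cseries_arrivals (l : R) (c f d : nat -> R) (x A : C) :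
  0 <= l <= 1 ->
  is_pmf f ->
  ex_series (fun n => Rabs (c n)) ->
  Cmod x <= 1 ->
  (forall n, is_series (fun i => f (S i) * steps l (S i) c n) (d n)) ->
  is_Cseries (fun n => (RtoC (c n) * x ^ n)%C) A ->
  is_Cseries (fun n => (RtoC (d n) * x ^ n)%C)
             (pgf f (RtoC (1 - l) + RtoC l * x) * A)%C.
Proof.
intros Hl Hf Ec Hx Hd HA.
assert (Hpg := is_Cseries_pgf f _ Hf (Cmod_arrival_le1 l x Hl Hx)).
apply (is_Cseries_scal A) in Hpg; rewrite Cmult_comm.
apply is_Cseries_Re_Im in Hpg; destruct Hpg as [HR HI].
set (y := (RtoC (1 - l) + RtoC l * x)%C) in *.
assert (HS := fun u => proj1 (is_Cseries_Re_Im _ _) (is_Cseries_steps l u c x A HA)).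
(* The real summation by columns is applied twice, with the real and the imaginary parts of [x ^ n]
   as weights; both are at most 1 in absolute value on the closed disc. *)
apply is_Cseries_Re_Im; split.
- rewrite <- (is_series_unique _ _ HR).
  rewrite (Series_ext _ (fun i => f (S i) * Re (y ^ S i * A)%C)).
  + eapply is_series_ext;
      [|apply (is_series_steps_weighted l c f d (fun n => Re (x ^ n))
                 (fun u => Re (y ^ u * A)%C) Hl Hf Ec)].
    * intros n; now rewrite Re_scal.
    * intros n; eapply Rle_trans; [apply re_le_Cmod|now apply Cmod_pow_le1].
    * exact Hd.
    * intros u; eapply is_series_ext; [|apply (proj1 (HS u))].
      intros n; apply Re_scal.
  + intros i; rewrite <- Re_scal; f_equal; ring.
- rewrite <- (is_series_unique _ _ HI).
  rewrite (Series_ext _ (fun i => f (S i) * Im (y ^ S i * A)%C)).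
  + eapply is_series_ext;
      [|apply (is_series_steps_weighted l c f d (fun n => Im (x ^ n))
                 (fun u => Im (y ^ u * A)%C) Hl Hf Ec)].
    * intros n; now rewrite Im_scal.
    * intros n; eapply Rle_trans; [apply im_le_Cmod|now apply Cmod_pow_le1].
    * exact Hd.
    * intros u; eapply is_series_ext; [|apply (proj2 (HS u))].
      intros n; apply Im_scal.
  + intros i; rewrite <- Im_scal; f_equal; ring.
Qed.

(** * Uniqueness of the coefficients of a generating function *)

Lemma CV_radius_pos (c : nat -> R) : ex_series c -> Rbar_lt 0 (CV_radius c).
Proof.
intros Hc; apply Rbar_lt_le_trans with 1; [simpl; lra|].
(* The terms of a convergent series are bounded, so the power series has bounded terms at 1. *)
apply CV_radius_bounded.
destruct (filterlim_bounded (K := R_AbsRing) (V := R_NormedModule) c) as [M HM].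
- exists 0; exact (ex_series_lim_0 c Hc).
- exists M; intros n; rewrite pow1, Rmult_1_r; apply HM.
Qed.

Lemma is_gf_coeffs_real (F : C -> C) (c : nat -> R) (x : R) :
  is_gf_coeffs F c -> Rabs x <= 1 ->
  is_series (fun n => c n * x ^ n) (Re (F (RtoC x))).
Proof.
intros H Hx; rewrite <- Cmod_R in Hx.
eapply is_series_ext; [|apply (proj1 (proj1 (is_Cseries_Re_Im _ _) (H _ Hx)))].
intros n; cbv beta; rewrite Re_scal, <- RtoC_pow; reflexivity.
Qed.

(** On the real axis this is the uniqueness of real power series that agree near 0. The value at 1
    makes the coefficients summable, hence the radius of convergence positive. *)
Lemma is_gf_coeffs_unique (F : C -> C) (c d : nat -> R) :
  is_gf_coeffs F c -> is_gf_coeffs F d -> forall n, c n = d n.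
Proof.
intros Hc Hd n.
assert (E : forall b, is_gf_coeffs F b -> ex_series b).
{ intros b Hb; exists (Re (F (RtoC 1))).
  eapply is_series_ext; [|apply (is_gf_coeffs_real F b 1 Hb)].
  - intros m; cbv beta; rewrite pow1; apply Rmult_1_r.
  - rewrite Rabs_R1; lra. }
apply PSeries_ext_recip; [now apply CV_radius_pos, E|now apply CV_radius_pos, E|].
exists (mkposreal 1 Rlt_0_1); intros x Hx.
assert (Hx1 : Rabs x <= 1).
{ change (Rabs (x - 0) < 1) in Hx; rewrite Rminus_0_r in Hx; lra. }
unfold PSeries; rewrite (is_series_unique _ _ (is_gf_coeffs_real F c x Hc Hx1)).
symmetry; apply is_series_unique, (is_gf_coeffs_real F d x Hd Hx1).
Qed.

Definition dirac0 (n : nat) : R := match n with O => 1 | S _ => 0 end.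

Lemma is_series_dirac0 : is_series dirac0 1.
Proof.
apply is_series_decr_1.
change (is_lim_seq (sum_n (fun _ => 0)) (1 + - 1)); rewrite Rplus_opp_r.
apply (is_lim_seq_ext (fun _ => 0)) with (2 := is_lim_seq_const 0).
intros n; unfold sum_n; now rewrite (sum_n_m_const_zero (G := R_AbelianMonoid)).
Qed.

Lemma is_Cseries_dirac0 (x : C) :
  is_Cseries (fun n => (RtoC (dirac0 n) * x ^ n)%C) (RtoC 1).
Proof.
apply is_Cseries_ext with (c := fun n => RtoC (dirac0 n)) (l := RtoC 1).
- intros [|n]; simpl; ring.
- reflexivity.
- apply is_Cseries_Re_Im; split; [exact is_series_dirac0|].
  apply (is_lim_seq_ext (fun _ => 0)) with (2 := is_lim_seq_const 0).
  intros n; unfold sum_n; symmetry; apply (sum_n_m_const_zero (G := R_AbelianMonoid)).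
Qed.

(* A source [r * dirac0] starts every service with an empty queue, so what is
   left behind is [r] times the number of arrivals. *)
Lemma arrivals_dirac0 (l r : R) (f d k : nat -> R) :
  0 <= l <= 1 ->
  is_pmf f ->
  is_gf_coeffs (fun x => pgf f (RtoC (1 - l) + RtoC l * x)%C) k ->
  (forall n, is_series (fun i => f (S i) * steps l (S i) (fun m => r * dirac0 m) n) (d n)) ->
  forall n, d n = r * k n.
Proof.
intros Hl Hf Hk Hd n.
(* Both sequences are coefficients of [r] times the generating function of the arrivals. *)
apply (is_gf_coeffs_unique
  (fun x => RtoC r * pgf f (RtoC (1 - l) + RtoC l * x))%C d (fun m => r * k m)).
- intros x Hx.
  eapply is_Cseries_ext; [reflexivity| |].
  2: apply (is_Cseries_arrivals l (fun m => r * dirac0 m) f d x (RtoC r)); try easy.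
  + ring.
  + apply ex_series_ext with (fun m => Rabs r * dirac0 m).
    * intros [|m]; simpl; rewrite Rabs_mult, ?Rabs_R1, ?Rabs_R0; reflexivity.
    * apply ex_series_Rscal; exists 1; exact is_series_dirac0.
  + eapply is_Cseries_ext; [| |apply (is_Cseries_scal (RtoC r)), (is_Cseries_dirac0 x)].
    * intros m; simpl; rewrite RtoC_mult; ring.
    * ring.
- intros x Hx; eapply is_Cseries_ext; [|reflexivity|apply (is_Cseries_scal (RtoC r)), (Hk x Hx)].
  intros m; simpl; rewrite RtoC_mult; ring.
Qed.

(** * Finite sums, and linearity and summability for [step] *)

Lemma Csum_ext (f g : nat -> C) (m n : nat) :
  (forall i, (m <= i <= n)%nat -> f i = g i) -> Csum f m n = Csum g m n.
Proof. apply sum_n_m_ext_loc. Qed.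

Lemma Csum_plus (f g : nat -> C) (m n : nat) :
  Csum (fun i => f i + g i)%C m n = (Csum f m n + Csum g m n)%C.
Proof. exact (sum_n_m_plus f g m n). Qed.

Lemma Csum_scal_r (z : C) (f : nat -> C) (m n : nat) :
  Csum (fun i => f i * z)%C m n = (Csum f m n * z)%C.
Proof. exact (sum_n_m_mult_r (K := C_Ring) z f m n). Qed.

Lemma Csum_Chasles (f : nat -> C) (m n p : nat) :
  (m <= S n)%nat -> (n <= p)%nat ->
  Csum f m p = (Csum f m n + Csum f (S n) p)%C.
Proof. exact (sum_n_m_Chasles f m n p). Qed.

Lemma Csum_first (f : nat -> C) (m n : nat) :
  (m <= n)%nat -> Csum f m n = (f m + Csum f (S m) n)%C.
Proof. exact (sum_Sn_m f m n). Qed.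

Lemma Csum_last (f : nat -> C) (m n : nat) :
  (m < n)%nat -> Csum f m n = (Csum f m (n - 1) + f n)%C.
Proof.
intros H; replace n with (S (n - 1)) at 1 3 by lia.
apply (sum_n_Sm f m (n - 1)); lia.
Qed.

Lemma RtoC_sum_n_m (f : nat -> R) (m n : nat) :
  RtoC (sum_n_m f m n) = Csum (fun i => RtoC (f i)) m n.
Proof.
unfold Csum; destruct (Nat.le_gt_cases m n) as [H|H];
  [|rewrite !sum_n_m_zero by lia; reflexivity].
induction H as [|n H IH]; [now rewrite !sum_n_n|].
rewrite !sum_n_Sm by lia; rewrite <- IH; apply RtoC_plus.
Qed.

Lemma sum_n_m_Rscal (r : R) (f : nat -> R) (m n : nat) :
  sum_n_m (fun i => r * f i) m n = r * sum_n_m f m n.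
Proof. exact (sum_n_m_mult_l (K := R_Ring) r f m n). Qed.

Lemma sum_n_m_Rplus (f g : nat -> R) (m n : nat) :
  sum_n_m (fun i => f i + g i) m n = sum_n_m f m n + sum_n_m g m n.
Proof. exact (sum_n_m_plus (G := R_AbelianMonoid) f g m n). Qed.

(** The bounds are asked for on the range of summation only, as [steady_state] gives the sign of
    [busy] for batch sizes from [qa] to [qb]. *)
Lemma sum_n_m_pos_le (f g : nat -> R) (m n : nat) :
  (forall i, (m <= i <= n)%nat -> 0 <= f i <= g i) ->
  0 <= sum_n_m f m n <= sum_n_m g m n.
Proof.
intros H; destruct (Nat.le_gt_cases m n) as [Hm|Hm];
  [|rewrite !sum_n_m_zero by lia; split; apply Rle_refl].
induction Hm as [|n Hm IH]; [rewrite !sum_n_n; apply H; lia|].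
rewrite !sum_n_Sm by lia; unfold plus; simpl.
generalize (H (S n) ltac:(lia)) (IH ltac:(intros i Hi; apply H; lia)); lra.
Qed.

Lemma steps_scal (l r : R) (u : nat) (c : nat -> R) (n : nat) :
  steps l u (fun m => r * c m) n = r * steps l u c n.
Proof.
replace (fun m => r * c m) with (fun m => c m + (r - 1) * c m)
  by (apply functional_extensionality; intros m; ring).
rewrite steps_linear; ring.
Qed.

Lemma ex_series_Rabs_step (l t : R) (a : nat -> R) :
  0 <= l <= 1 -> (forall n, 0 <= a n) -> ex_series a ->
  ex_series (fun n => Rabs (t * step l a n)).
Proof.
intros Hl Ha Ea.
assert (E : ex_series (step l a)).
{ apply ex_series_incr_1.
  apply (ex_series_plus (V := R_NormedModule)
    (fun n => (1 - l) * a (S n)) (fun n => l * a n)).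
  - apply ex_series_Rscal; now apply ex_series_incr_1 in Ea.
  - now apply ex_series_Rscal. }
apply ex_series_ext with (fun n => Rabs t * step l a n).
- intros n; rewrite Rabs_mult, (Rabs_pos_eq (step l a n)); [reflexivity|].
  destruct n as [|n]; simpl; [generalize (Ha O); nra|].
  generalize (Ha (S n)) (Ha n); nra.
- now apply ex_series_Rscal.
Qed.

(** * The queue at completion epochs *)

Section Epochs.

Variables (q : queue) (P : probs).
Hypotheses (Hq : valid_queue q) (HP : steady_state q P).

Let t := / tau q P.

Lemma lam_01 : 0 <= lam q <= 1.
Proof. generalize (vq_lam q Hq); lra. Qed.

(** A completion epoch comes one slot of arrivals after a state with remaining time 1. *)
Lemma pplus2_step (n r : nat) :
  pplus2 q P n r = t * step (lam q) (fun m => busy P m r 1) n.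
Proof. now destruct n. Qed.

Lemma Qplus_step (n : nat) :
  Qplus q P n = t * step (lam q) (fun m => vacn P m 1) n.
Proof. now destruct n. Qed.

Lemma pplus_pos (n : nat) : (1 <= n)%nat ->
  pplus q P n =
  t * sum_n_m (fun m => lamb q * busy P n m 1 + lam q * busy P (n - 1) m 1)
              (qa q) (qb q).
Proof.
intros Hn; unfold pplus; rewrite <- sum_n_m_Rscal; apply sum_n_m_ext_loc; intros r _.
destruct n as [|n]; [lia|].
simpl; now rewrite Nat.sub_0_r.
Qed.

Lemma Qplus_pos (n : nat) : (1 <= n)%nat ->
  Qplus q P n = t * (lamb q * vacn P n 1 + lam q * vacn P (n - 1) 1).
Proof. intros Hn; destruct n as [|n]; [lia|]; simpl; now rewrite Nat.sub_0_r. Qed.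

Lemma pplus_step (n : nat) :
  pplus q P n =
  t * step (lam q) (fun m => sum_n_m (fun r => busy P m r 1) (qa q) (qb q)) n.
Proof.
unfold pplus; destruct n as [|n]; simpl; rewrite sum_n_m_Rscal; f_equal.
- apply sum_n_m_Rscal.
- now rewrite sum_n_m_Rplus, !sum_n_m_Rscal.
Qed.

(** [balance_unroll] at a fixed batch size, scaled by [t]; [c m] is the rate at which such services
    start with [m] customers left in the queue. *)
Lemma service_series (r n : nat) (c : nat -> R) :
  (qa q <= r <= qb q)%nat ->
  (forall m u, busy P m r (S u) =
     step (lam q) (fun i => busy P i r (S (S u))) m + c m * svc q r (S u)) ->
  is_series (fun i => svc q r (S i) *
                      steps (lam q) (S i) (fun m => t * c m) n)
            (pplus2 q P n r).
Proof.
intros Hr Hb; rewrite pplus2_step.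
eapply is_series_Rext;
  [|apply (is_series_Rscal t), (balance_unroll (lam q) (fun m u => busy P m r u) c (svc q r) n)].
- intros i; rewrite steps_scal; ring.
- exact lam_01.
- intros m u; apply (ss_busy_ge0 q P HP); [exact Hr|lia].
- intros m; now apply (ss_busy_ex q P HP).
- exact Hb.
Qed.

Lemma vacation_series (n : nat) (c : nat -> R) :
  (forall m u, vacn P m (S u) =
     step (lam q) (fun i => vacn P i (S (S u))) m + c m * vac q (S u)) ->
  is_series (fun i => vac q (S i) *
                      steps (lam q) (S i) (fun m => t * c m) n)
            (Qplus q P n).
Proof.
intros Hb; rewrite Qplus_step.
eapply is_series_Rext;
  [|apply (is_series_Rscal t), (balance_unroll (lam q) (vacn P) c (vac q) n)].
- intros i; rewrite steps_scal; ring.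
- exact lam_01.
- intros m u; apply (ss_vacn_ge0 q P HP); lia.
- apply (ss_vacn_ex q P HP).
- exact Hb.
Qed.

(** For single vacations, the balance of dormant state [n] says that [lam * dorm n] exceeds
    [lam * dorm (n - 1)] by the rate of vacations ending with [n] customers; summing telescopes. For
    multiple vacations both sides vanish. *)
Lemma dorm_Qplus (n : nat) : (n <= qa q - 1)%nat ->
  t * ((1 - delta q) * lam q * dorm P n) =
  (1 - delta q) * sum_n_m (fun m => Qplus q P m) 0 n.
Proof.
destruct (vq_delta q Hq) as [Hd|Hd]; rewrite Hd; [|intros _; ring].
induction n as [|n IH]; intros Hn.
- generalize (ss_dorm_0 q P HP); rewrite Hd, sum_n_n; intros E.
  change (Qplus q P 0) with (t * (lamb q * vacn P 0 1)); unfold lamb in *.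
  replace ((1 - lam q) * vacn P 0 1) with (lam q * dorm P 0) by lra; ring.
- generalize (ss_dorm_n q P HP (S n) ltac:(lia)); rewrite Hd, sum_n_Sm by lia.
  replace (S n - 1)%nat with n by lia; intros E.
  change (plus ?u ?v) with (u + v).
  rewrite Rmult_plus_distr_l, <- IH by lia.
  change (Qplus q P (S n)) with (t * (lamb q * vacn P (S n) 1 + lam q * vacn P n 1)).
  unfold lamb in *.
  replace ((1 - lam q) * vacn P (S n) 1 + lam q * vacn P n 1)
    with (lam q * dorm P (S n) - lam q * dorm P n) by lra; ring.
Qed.

(* [D n] is the rate of epochs leaving [n] customers, i.e. [p^+_n + Q^+_n]
   before the division by [tau]. *)
Let D (n : nat) : R :=
  sum_n_m (fun m => lamb q * busy P n m 1 + lam q * busy P (n - 1) m 1)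
          (qa q) (qb q)
  + lamb q * vacn P n 1 + lam q * vacn P (n - 1) 1.

(** At [n = 0] the truncated [n - 1] in [D] would add a spurious arrival term, hence the bound on
    [n]. *)
Lemma epoch_rate (n : nat) : (1 <= n)%nat -> t * D n = pplus q P n + Qplus q P n.
Proof. intros Hn; rewrite pplus_pos, Qplus_pos by easy; unfold D; ring. Qed.

(** A batch of fewer than [qb] customers takes everyone waiting, so its source is concentrated at
    queue length 0. *)
Lemma service_balance_lt (r : nat) (c : R) :
  (qa q <= r <= qb q - 1)%nat ->
  (forall u, busy P 0 r (S u) = lamb q * busy P 0 r (S (S u)) + c * svc q r (S u)) ->
  forall n, is_series (fun i => svc q r (S i) *
                steps (lam q) (S i) (fun m => t * c * dirac0 m) n)
              (pplus2 q P n r).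
Proof.
intros Hr H0 n.
replace (fun m => t * c * dirac0 m) with (fun m => t * (c * dirac0 m))
  by (apply functional_extensionality; intros m; ring).
apply service_series; [generalize (vq_a q Hq); lia|].
intros [|m] u; simpl.
- rewrite H0; unfold lamb; ring.
- rewrite (ss_busy_nr q P HP) by lia.
  replace (S u + 1)%nat with (S (S u)) by lia.
  replace (S m - 1)%nat with m by lia; unfold lamb; ring.
Qed.

Lemma pplus2_a (k : nat -> R) (n : nat) :
  (qa q < qb q)%nat -> is_gf_coeffs (Kgf q (qa q)) k ->
  pplus2 q P n (qa q) =
    ((1 - delta q) * sum_n_m (fun m => Qplus q P m) 0 (qa q - 1) +
     pplus q P (qa q) + Qplus q P (qa q)) * k n.
Proof.
intros Hab Hk; assert (Ha := vq_a q Hq).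
apply (arrivals_dirac0 (lam q) _ (svc q (qa q)) (fun n => pplus2 q P n (qa q)));
  [exact lam_01|apply (vq_svc_pmf q Hq); lia|exact Hk|].
(* The vacation sum becomes the rate of arrivals to the dormant state with [qa - 1] customers, and
   the bracket becomes [t] times the source in the balance equation of [busy P 0 (qa q)]. *)
rewrite <- dorm_Qplus, Rplus_assoc, <- epoch_rate by lia.
rewrite <- Rmult_plus_distr_l, (Rplus_comm _ (D _)).
apply service_balance_lt; [lia|]; intros u.
rewrite (ss_busy_0a q P HP) by lia.
replace (S u + 1)%nat with (S (S u)) by lia; reflexivity.
Qed.

Lemma pplus2_mid (k : nat -> R) (n r : nat) :
  (qa q + 1 <= r <= qb q - 1)%nat -> is_gf_coeffs (Kgf q r) k ->
  pplus2 q P n r = (pplus q P r + Qplus q P r) * k n.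
Proof.
intros Hr Hk.
apply (arrivals_dirac0 (lam q) _ (svc q r) (fun n => pplus2 q P n r));
  [exact lam_01|apply (vq_svc_pmf q Hq); lia|exact Hk|].
rewrite <- epoch_rate by lia.
apply service_balance_lt; [lia|]; intros u.
rewrite (ss_busy_0r q P HP) by lia.
replace (S u + 1)%nat with (S (S u)) by lia; reflexivity.
Qed.

(** An epoch leaving [qb + m] customers starts a full batch and leaves [m] in the queue. As
    [qa < qb], the equation for [m = 0] is [ss_busy_0r] at [r = qb]. *)
Lemma pplus2_b_series (n : nat) :
  (qa q < qb q)%nat ->
  is_series (fun i => svc q (qb q) (S i) *
     steps (lam q) (S i)
       (fun m => pplus q P (qb q + m) + Qplus q P (qb q + m)) n)
    (pplus2 q P n (qb q)).
Proof.
intros Hab.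
replace (fun m => pplus q P (qb q + m) + Qplus q P (qb q + m))
  with (fun m => t * D (qb q + m))
  by (apply functional_extensionality; intros m; apply epoch_rate; lia).
apply service_series; [lia|].
intros [|m] u; simpl.
- rewrite (ss_busy_0r q P HP) by lia.
  replace (S u + 1)%nat with (S (S u)) by lia.
  rewrite Nat.add_0_r; reflexivity.
- rewrite (ss_busy_nb q P HP) by lia.
  replace (S u + 1)%nat with (S (S u)) by lia.
  replace (S m - 1)%nat with m by lia.
  rewrite (Nat.add_comm (qb q)); reflexivity.
Qed.

(* Vacations start with fewer than [qa q] waiting customers. *)
Let vsource (n : nat) : R :=
  if (n <? qa q)%nat then pplus q P n + delta q * Qplus q P n else 0.

Lemma Qplus_series (n : nat) :
  is_series (fun i => vac q (S i) * steps (lam q) (S i) vsource n) (Qplus q P n).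
Proof.
assert (Ha := vq_a q Hq).
(* The vacation source before scaling by [t]; writing it with [step] treats an empty and a nonempty
   queue alike. *)
set (c := fun n =>
  if (n <? qa q)%nat then
    step (lam q) (fun m => sum_n_m (fun r => busy P m r 1) (qa q) (qb q)) n
    + delta q * step (lam q) (fun m => vacn P m 1) n
  else 0).
replace vsource with (fun m => t * c m).
2:{ apply functional_extensionality; intros m; unfold vsource, c.
    rewrite pplus_step, Qplus_step; destruct (m <? qa q)%nat; ring. }
apply vacation_series; intros m u; unfold c.
destruct (Nat.ltb_spec m (qa q)) as [Hm|Hm].
- destruct m as [|m]; simpl step.
  + rewrite (ss_vacn_0 q P HP) by lia.
    replace (S u + 1)%nat with (S (S u)) by lia; unfold lamb; ring.
  + rewrite (ss_vacn_lt q P HP), sum_n_m_Rplus, !sum_n_m_Rscal by lia.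
    replace (S u + 1)%nat with (S (S u)) by lia.
    replace (S m - 1)%nat with m by lia; unfold lamb; ring.
- destruct m as [|m]; [lia|]; simpl step.
  rewrite (ss_vacn_ge q P HP) by lia.
  replace (S u + 1)%nat with (S (S u)) by lia.
  replace (S m - 1)%nat with m by lia; unfold lamb; ring.
Qed.

(** * Generating functions of the epoch probabilities *)

Lemma is_Cseries_vsource (x : C) :
  is_Cseries (fun n => (RtoC (vsource n) * x ^ n)%C)
    (Csum (fun n => RtoC (pplus q P n) * x ^ n) 0 (qa q - 1) +
     RtoC (delta q) * Csum (fun n => RtoC (Qplus q P n) * x ^ n) 0 (qa q - 1))%C.
Proof.
assert (Ha := vq_a q Hq).
eapply is_Cseries_ext; [reflexivity| |apply (is_Cseries_decr_n _ (qa q - 1) (RtoC 0))].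
- rewrite (Csum_ext _ (fun n => RtoC (pplus q P n) * x ^ n +
    RtoC (Qplus q P n) * x ^ n * RtoC (delta q))%C).
  + rewrite Csum_plus, Csum_scal_r; ring.
  + intros n Hn; unfold vsource.
    replace (n <? qa q)%nat with true by (symmetry; apply Nat.ltb_lt; lia).
    rewrite RtoC_plus, RtoC_mult; ring.
- eapply is_Cseries_ext; [| |apply (is_Cseries_scal (RtoC 0)), (is_Cseries_dirac0 x)].
  + intros n; unfold vsource.
    replace (_ <? qa q)%nat with false by (symmetry; apply Nat.ltb_ge; lia).
    ring.
  + ring.
Qed.

Lemma ex_series_vsource : ex_series (fun n => Rabs (vsource n)).
Proof.
assert (Ha := vq_a q Hq).
apply (ex_series_incr_n _ (qa q)); exists 0.
apply (is_lim_seq_ext (fun _ => 0)) with (2 := is_lim_seq_const 0).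
intros n; unfold sum_n; symmetry.
rewrite (sum_n_m_ext _ (fun _ => zero)); [apply (sum_n_m_const_zero (G := R_AbelianMonoid))|].
intros m; unfold vsource.
replace (_ <? qa q)%nat with false by (symmetry; apply Nat.ltb_ge; lia).
apply Rabs_R0.
Qed.

(** The probability of remaining time 1 is at most the total over all remaining times, and these
    totals are summable by the normalization. *)
Lemma ex_series_epochs : ex_series (fun n => Rabs (pplus q P n + Qplus q P n)).
Proof.
assert (Hbusy : forall n r, (qa q <= r <= qb q)%nat -> 0 <= busy P n r 1 <= busy_tot P n r).
{ intros n r Hr; split; [apply (ss_busy_ge0 q P HP); [easy|lia]|].
  apply (term_le_Series (fun i => busy P n r (S i)) 0).
  - intros i; apply (ss_busy_ge0 q P HP); [easy|lia].
  - now apply (ss_busy_ex q P HP). }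
assert (Hvac : forall n, 0 <= vacn P n 1 <= vacn_tot P n).
{ intros n; split; [apply (ss_vacn_ge0 q P HP); lia|].
  apply (term_le_Series (fun i => vacn P n (S i)) 0).
  - intros i; apply (ss_vacn_ge0 q P HP); lia.
  - apply (ss_vacn_ex q P HP). }
assert (Hsum := fun n => sum_n_m_pos_le _ _ (qa q) (qb q) (Hbusy n)).
apply ex_series_Rle with (fun n => Rabs (pplus q P n) + Rabs (Qplus q P n)).
- intros n; rewrite Rabs_Rabsolu; apply Rabs_triang.
- apply (ex_series_plus (V := R_NormedModule)
    (fun n => Rabs (pplus q P n)) (fun n => Rabs (Qplus q P n))).
  + rewrite (functional_extensionality (pplus q P) _ pplus_step).
    apply ex_series_Rabs_step; [exact lam_01|apply Hsum|].
    apply ex_series_Rle with (2 := ss_busy_tot_ex q P HP).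
    intros n; rewrite Rabs_pos_eq; apply Hsum.
  + rewrite (functional_extensionality (Qplus q P) _ Qplus_step).
    apply ex_series_Rabs_step; [exact lam_01|apply Hvac|].
    apply ex_series_Rle with (2 := ss_vacn_tot_ex q P HP).
    intros n; rewrite Rabs_pos_eq; apply Hvac.
Qed.

Lemma is_Cseries_Qplus (x : C) :
  Cmod x <= 1 ->
  is_Cseries (fun n => (RtoC (Qplus q P n) * x ^ n)%C)
    (Hgf q x *
     (Csum (fun n => RtoC (pplus q P n) * x ^ n) 0 (qa q - 1) +
      RtoC (delta q) * Csum (fun n => RtoC (Qplus q P n) * x ^ n) 0 (qa q - 1)))%C.
Proof.
intros Hx; apply (is_Cseries_arrivals (lam q) vsource (vac q)).
- exact lam_01.
- exact (vq_vac_pmf q Hq).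
- exact ex_series_vsource.
- exact Hx.
- exact Qplus_series.
- exact (is_Cseries_vsource x).
Qed.

(* Both sides are the generating function of [p^+_n + Q^+_n]: on the left cut
   at [n = qb q], on the right split according to the kind of epoch. *)
Lemma epoch_gf (k : nat -> nat -> R) (x : C) :
  (qa q < qb q)%nat ->
  (forall r, (qa q <= r <= qb q)%nat -> is_gf_coeffs (Kgf q r) (k r)) ->
  Cmod x <= 1 ->
  exists G : C,
    is_Cseries (fun n => (RtoC (pplus2 q P n (qb q)) * x ^ n)%C)
               (Kgf q (qb q) x * G)%C /\
    (Csum (fun n => RtoC (pplus q P n + Qplus q P n) * x ^ n) 0 (qb q - 1)
       + x ^ qb q * G =
     RtoC (1 - delta q) * Csum (fun n => RtoC (Qplus q P n)) 0 (qa q - 1) *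
       Kgf q (qa q) x
     + Csum (fun r => RtoC (pplus q P r + Qplus q P r) * Kgf q r x)
            (qa q) (qb q - 1)
     + Kgf q (qb q) x * G
     + Hgf q x *
       (Csum (fun n => RtoC (pplus q P n) * x ^ n) 0 (qa q - 1) +
        RtoC (delta q) *
        Csum (fun n => RtoC (Qplus q P n) * x ^ n) 0 (qa q - 1)))%C.
Proof.
intros Hab Hk Hx.
assert (Ec : ex_series (fun n => Rabs (pplus q P (qb q + n) + Qplus q P (qb q + n))))
  by exact (proj1 (ex_series_incr_n _ (qb q)) ex_series_epochs).
assert (HG := is_Cseries_abs _ (fun n => (x ^ n)%C) Ec (fun n => Cmod_pow_le1 x n Hx)).
(* [G] is the generating function of the source of full batches, with coefficients [pplus + Qplus]
   at [qb + n]. *)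
set (G := CSeries _) in HG.
assert (Hb : is_Cseries (fun n => (RtoC (pplus2 q P n (qb q)) * x ^ n)%C)
               (Kgf q (qb q) x * G)%C).
{ apply (is_Cseries_arrivals (lam q)
    (fun m => pplus q P (qb q + m) + Qplus q P (qb q + m)) (svc q (qb q))).
  - exact lam_01.
  - apply (vq_svc_pmf q Hq); lia.
  - exact Ec.
  - exact Hx.
  - intros n; now apply pplus2_b_series.
  - exact HG. }
exists G; split; [exact Hb|].
apply (is_Cseries_eq (fun n => (RtoC (pplus q P n + Qplus q P n) * x ^ n)%C)).
- apply is_Cseries_decr_n.
  eapply is_Cseries_ext; [|reflexivity|apply (is_Cseries_scal (x ^ qb q)%C), HG].
  intros n; cbv beta; replace (S (qb q - 1) + n)%nat with (qb q + n)%nat by lia.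
  rewrite Cpow_add_r; ring.
(* The term [r = qa] is set apart because its coefficient carries the dormant contribution. The four
   series added are batches of size [qa], intermediate batches, full batches and vacations. *)
- rewrite (Csum_first _ (qa q)) by lia.
  eapply is_Cseries_ext; [| |
    apply is_Cseries_plus; [apply is_Cseries_plus; [apply is_Cseries_plus|]|]].
  3: apply (is_Cseries_scal (RtoC ((1 - delta q) *
       sum_n_m (fun m => Qplus q P m) 0 (qa q - 1) + pplus q P (qa q) + Qplus q P (qa q)))),
       (Hk (qa q)); [lia|exact Hx].
  3: apply (is_Cseries_Csum
       (fun r n => RtoC (pplus q P r + Qplus q P r) * (RtoC (k r n) * x ^ n))%C
       (fun r => RtoC (pplus q P r + Qplus q P r) * Kgf q r x)%C (S (qa q)) (qb q - 1)).
  3: intros r Hr; apply is_Cseries_scal, Hk; [lia|exact Hx].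
  3: exact Hb.
  3: exact (is_Cseries_Qplus x Hx).
  + intros n; cbv beta; rewrite (RtoC_plus (pplus q P n) (Qplus q P n)).
    assert (Epp : RtoC (pplus q P n) =
      (RtoC (pplus2 q P n (qa q)) +
       Csum (fun r => RtoC (pplus2 q P n r)) (S (qa q)) (qb q - 1) +
       RtoC (pplus2 q P n (qb q)))%C).
    { unfold pplus; rewrite RtoC_sum_n_m, Csum_last, Csum_first by lia; ring. }
    rewrite Epp, (pplus2_a (k (qa q))) by (try apply Hk; lia).
    rewrite RtoC_mult.
    rewrite (Csum_ext (fun r => RtoC (pplus q P r + Qplus q P r) * (RtoC (k r n) * x ^ n))%C
      (fun r => RtoC (pplus2 q P n r) * x ^ n)%C).
    * rewrite Csum_scal_r; ring.
    * intros r Hr; rewrite (pplus2_mid (k r)) by (try apply Hk; lia).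
      rewrite RtoC_mult; ring.
  + rewrite !RtoC_plus, RtoC_mult, <- (RtoC_sum_n_m (fun m => Qplus q P m)); ring.
Qed.

End Epochs.

(** * Solving the linear equation for the generating function of full batches *)

Theorem mainTheorem3 (q : queue) (P : probs) (k : nat -> nat -> R)
  (Hq : valid_queue q)
  (Hab : (qa q < qb q)%nat)
  (HP : steady_state q P)
  (Hk : forall r : nat, (qa q <= r <= qb q)%nat ->
          is_gf_coeffs (Kgf q r) (k r)) :
  (forall n : nat,
     pplus2 q P n (qa q) =
       ((1 - delta q) * sum_n_m (fun m => Qplus q P m) 0 (qa q - 1) +
        pplus q P (qa q) + Qplus q P (qa q)) * k (qa q) n) /\
  (forall n j : nat, (qa q + 1 <= j <= qb q - 1)%nat ->
     pplus2 q P n j = (pplus q P j + Qplus q P j) * k j n) /\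
  (forall x : C,
     Cmod x <= 1 -> x <> RtoC 0 -> (x ^ qb q)%C <> Kgf q (qb q) x ->
     is_Cseries
       (fun n => (RtoC (pplus2 q P n (qb q)) * x ^ n)%C)
       (/ (x ^ qb q - Kgf q (qb q) x) *
          (Csum (fun n => RtoC (pplus q P n) * x ^ n) 0 (qa q - 1) *
             (Hgf q x - 1) * Kgf q (qb q) x +
           RtoC (1 - delta q) * Kgf q (qa q) x * Kgf q (qb q) x *
             Csum (fun n => RtoC (Qplus q P n)) 0 (qa q - 1) +
           (RtoC (delta q) * Hgf q x - 1) *
             Csum (fun n => RtoC (Qplus q P n) * x ^ n) 0 (qa q - 1) *
             Kgf q (qb q) x +
           Csum (fun n => RtoC (pplus q P n + Qplus q P n) *
                          (Kgf q n x - / x ^ (qb q - n) * Kgf q (qb q) x))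
                (qa q) (qb q - 1) * Kgf q (qb q) x) -
        Csum (fun n => RtoC (pplus q P n + Qplus q P n) *
                       / x ^ (qb q - n) * Kgf q (qb q) x)
             (qa q) (qb q - 1))%C).
Proof.
split; [|split].
- intros n; apply pplus2_a; try easy; apply Hk; lia.
- intros n j Hj; apply pplus2_mid; try easy; apply Hk; lia.
- intros x Hx Hx0 HxK.
  destruct (epoch_gf q P Hq HP k x Hab Hk Hx) as [G [HG EG]].
  eapply is_Cseries_ext; [reflexivity| |exact HG].
  assert (Ha := vq_a q Hq).
  assert (Hxb : (x ^ qb q)%C <> RtoC 0) by now apply Cpow_nz.
  assert (HxK' : (x ^ qb q - Kgf q (qb q) x)%C <> RtoC 0).
  { intros E; apply HxK; rewrite <- (Cplus_0_r (Kgf q (qb q) x)), <- E; ring. }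
  (* Factoring [x ^ (n - b)] as [x ^ n / x ^ b] reduces every sum with a negative exponent to the
     single quantity [W]. *)
  assert (Einv : forall n, (n <= qb q - 1)%nat ->
    (/ x ^ (qb q - n) = x ^ n * / x ^ qb q)%C).
  { intros n Hn; replace (qb q) with (qb q - n + n)%nat at 2 by lia.
    rewrite Cpow_add_r; field; split; now apply Cpow_nz. }
  rewrite (Csum_Chasles _ 0 (qa q - 1)) in EG by lia.
  replace (S (qa q - 1)) with (qa q) in EG by lia.
  rewrite (Csum_ext _ (fun n => RtoC (pplus q P n) * x ^ n +
    RtoC (Qplus q P n) * x ^ n)%C 0 (qa q - 1)) in EG
    by (intros; rewrite RtoC_plus; ring).
  rewrite Csum_plus in EG.
  set (W := Csum (fun n => RtoC (pplus q P n + Qplus q P n) * x ^ n)%C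
                 (qa q) (qb q - 1)) in EG.
  rewrite (Csum_ext (fun n => RtoC (pplus q P n + Qplus q P n) *
      / x ^ (qb q - n) * Kgf q (qb q) x)%C
    (fun n => RtoC (pplus q P n + Qplus q P n) * x ^ n *
      (/ x ^ qb q * Kgf q (qb q) x))%C)
    by (intros n Hn; rewrite Einv by lia; ring).
  rewrite Csum_scal_r; fold W.
  rewrite (Csum_ext (fun n => RtoC (pplus q P n + Qplus q P n) *
      (Kgf q n x - / x ^ (qb q - n) * Kgf q (qb q) x))%C
    (fun n => RtoC (pplus q P n + Qplus q P n) * Kgf q n x +
      RtoC (pplus q P n + Qplus q P n) * x ^ n *
      (- / x ^ qb q * Kgf q (qb q) x))%C)
    by (intros n Hn; rewrite Einv by lia; ring).
  rewrite Csum_plus, Csum_scal_r; fold W.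
  set (SK := Csum (fun n => RtoC (pplus q P n + Qplus q P n) * Kgf q n x)%C _ _) in *.
  set (PA := Csum (fun n => RtoC (pplus q P n) * x ^ n)%C _ _) in *.
  set (QA := Csum (fun n => RtoC (Qplus q P n) * x ^ n)%C _ _) in *.
  set (SQ := Csum (fun n => RtoC (Qplus q P n)) _ _) in *.
  set (xb := (x ^ qb q)%C) in *; set (Kb := Kgf q (qb q) x) in *.
  assert (E : G = (/ (xb - Kb) * (RtoC (1 - delta q) * SQ * Kgf q (qa q) x + SK
    + Hgf q x * (PA + RtoC (delta q) * QA) - (PA + QA + W)))%C).
  (* Adding and subtracting [PA + QA + W] makes the left side of [EG] appear, ready to be
     rewritten. *)
  { transitivity (/ (xb - Kb) * (PA + QA + W + xb * G - Kb * G - (PA + QA + W)))%C.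
    - field; exact HxK'.
    - rewrite EG; field; exact HxK'. }
  (* The two occurrences of [W] in the goal combine to [- W * Kb / (xb - Kb)], because
     [Kb / xb + (xb - Kb) / xb = 1]. *)
  rewrite E; field; split; assumption.
Qed.
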